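(* Let $\alpha,\beta\ge1$ be real numbers and let $j\in\mathbb{Q}$. As $X\to\infty$, $$\frac{\#\mathcal{E}_j(X;H_{\alpha,\beta})}{\#\widetilde{\mathcal{E}}_j(X;H_{\alpha,\beta})}=\begin{cases}\dfrac{1}{\zeta(6)}+O(X^{-5/12}) & \text{for } j=0,\\[6pt] \dfrac{1}{\zeta(4)}+O(X^{-1/4}) & \text{for } j=1728,\\[6pt] \dfrac{1}{\zeta(2)}+O(X^{-1/12}) & \text{for } j\neq0,1728.\end{cases}$$
   Context: For $(A,B)\in\mathbb{Z}^2$ let $E_{A,B}$ denote the curve $y^2=x^3+Ax+B$; curves are counted by their pairs $(A,B)$. Let $\widetilde{\mathcal{E}}$ be the set of all $E_{A,B}$ with $A,B\in\mathbb{Z}$ and $-16(4A^3+27B^2)\neq 0$. Let $\mathcal{E}$ be the set of $E_{A,B}\in\widetilde{\mathcal{E}}$ such that there is no prime $p$ with $p^4\mid A$ and $p^6\mid B$ (a complete set of representatives for the $\mathbb{Q}$-isomorphism classes of elliptic curves over $\mathbb{Q}$). The $j$-invariant is $j(E_{A,B})=1728\cdot\frac{4A^3}{4A^3+27B^2}$. For $j\in\mathbb{Q}$, $\widetilde{\mathcal{E}}_j:=\{E_{A,B}\in\widetilde{\mathcal{E}}: j(E_{A,B})=j\}$ and $\mathcal{E}_j:=\{E_{A,B}\in\mathcal{E}: j(E_{A,B})=j\}$. For real $\alpha,\beta\ge1$, $H_{\alpha,\beta}(E_{A,B}):=\max\{\alpha|A|^3,\beta B^2\}$, and for a family $\mathcal{F}$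 and $X>0$, $\mathcal{F}(X;H_{\alpha,\beta}):=\{E_{A,B}\in\mathcal{F}: H_{\alpha,\beta}(E_{A,B})\le X\}$. $\zeta$ is the Riemann zeta function. The parameters $\alpha,\beta,j$ are fixed; the implied constants may depend on them. *)

(* Defs.v *)
From HB Require Import structures.
From mathcomp Require Export all_boot all_order all_algebra finmap.
From mathcomp Require Export all_classical all_reals all_analysis.
Export Order.TTheory GRing.Theory Num.Theory numFieldNormedType.Exports.

Set Implicit Arguments.
Unset Strict Implicit.
Unset Printing Implicit Defensive.

Local Open Scope classical_set_scope.
Local Open Scope ring_scope.

(* The curve y^2 = x^3 + A x + B is represented by the pair (A, B). *)
Definition curve : Type := (int * int)%type.

Definition disc (E : curve) : int := - 16 * (4 * E.1 ^+ 3 + 27 * E.2 ^+ 2).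

Definition jinv (E : curve) : rat :=
  1728 * ((4 * E.1%:~R ^+ 3) / (4 * E.1%:~R ^+ 3 + 27 * E.2%:~R ^+ 2)).

Definition all_curves : set curve := [set E | disc E != 0].

Definition minimal_curves : set curve :=
  [set E | all_curves E /\
     ~ exists p : nat,
         [/\ prime p, (p%:Z ^+ 4 %| E.1)%Z & (p%:Z ^+ 6 %| E.2)%Z]].

Definition with_jinv (F : set curve) (j : rat) : set curve :=
  [set E | F E /\ jinv E = j].

Definition height (R : realType) (alpha beta : R) (E : curve) : R :=
  Num.max (alpha * `|E.1%:~R| ^+ 3) (beta * E.2%:~R ^+ 2).

Definition height_le (R : realType) (F : set curve) (alpha beta X : R) :
    set curve :=
  [set E | F E /\ height alpha beta E <= X].

(* [fset_set] sends infinite sets to the empty one, but since alpha, beta >= 1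
   only finitely many curves have bounded height. *)
Definition count (R : realType) (F : set curve) (alpha beta X : R) : nat :=
  #|` fset_set (height_le F alpha beta X)|%fset.

(* The Landau notations need a bundled filter; the library bundles none for
   +oo. *)
Canonical pinfty_filter_on (R : realType) : filter_on R :=
  FilterType (pinfty_nbhs R) _.

(* Dirichlet series of the Riemann zeta function, for real s > 1. *)
Definition zeta (R : realType) (s : R) : R :=
  limn (series (fun n : nat => n.+1%:R `^ (- s))).

(* Main.v *)
Require Import Defs.
From mathcomp Require Import zify ring lra.

(* For each j the curves with that j-invariant form one family f(d), d a nonzero
   integer, on which the height is C |d|^r and f(d) is minimal iff d is k-th
   power free: f(d) = (0, d), r = 2, k = 6 for j = 0; f(d) = (d, 0), r = 3, k = 4
   for j = 1728; and f(d) = (A0 d^2, B0 d^3), r = 6, k = 2 otherwise, (A0, B0)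
   being a curve not divisible by any (p^2, p^3). So the ratio is the density of
   k-free integers up to N ~ (X / C)^(1/r). Summing mu(d) over d^k | n gives
   N / zeta(k) + O(N^(1/k)) such integers, hence an error O(X^(-(1 - 1/k)/r)). *)

Set Implicit Arguments.
Unset Strict Implicit.
Unset Printing Implicit Defensive.

Local Open Scope classical_set_scope.
Local Open Scope ring_scope.

(** * Power-free integers and the Möbius function *)

(** For [k] positive, only primes dividing [n] can violate the condition. Since [primes 0] is empty,
    the value at 0 is a vacuous [true], whence the positivity hypotheses below. *)
Definition pfree (k n : nat) : bool :=
  all (fun p => ~~ (p ^ k %| n)%N) (primes n).

(** The classical Möbius function for positive [n]; the value at 0 is 1 by default. *)
Definition mobius (n : nat) : int :=
  if all (fun p => logn p n == 1%N) (primes n) then (-1) ^+ size (primes n)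
  else 0.

Lemma pfreePn (k n : nat) : (0 < k)%N -> (0 < n)%N ->
  reflect (exists p, prime p /\ (p ^ k %| n)%N) (~~ pfree k n).
Proof.
move=> k0 n0; rewrite -has_predC; apply: (iffP hasP) => /=.
  by case=> p; rewrite mem_primes negbK => /and3P[? _ _] ?; exists p.
case=> p [pp pn]; exists p; rewrite ?negbK// mem_primes pp n0/=.
exact: dvdn_trans (dvdn_exp k0 (dvdnn p)) pn.
Qed.

Lemma normr_mobius (n : nat) : `|mobius n| <= 1.
Proof. by rewrite /mobius; case: ifP => _; rewrite ?normr0// normrX normrN1 expr1n. Qed.

Lemma mobius_mul_prime (p d : nat) : prime p -> (0 < d)%N -> ~~ (p %| d)%N ->
  mobius (p * d) = - mobius d.
Proof.
move=> pp d0 pd; rewrite /mobius.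
have p0 := prime_gt0 pp.
have H : perm_eq (primes (p * d)) (p :: primes d).
  apply: uniq_perm; rewrite ?primes_uniq//=.
    by rewrite primes_uniq mem_primes (negbTE pd) !andbF.
  by move=> q; rewrite primesM// primes_prime// !inE.
rewrite (perm_all _ H) (perm_size H)/= lognM// logn_prime// eqxx.
have -> : logn p d = 0%N.
  by apply/eqP; rewrite -leqn0 leqNgt logn_gt0 mem_primes (negbTE pd) !andbF.
rewrite addn0 eqxx/= (_ : all _ _ = all (fun q => logn q d == 1%N) (primes d)).
  by case: ifP => _; rewrite ?oppr0// exprS mulN1r.
apply: eq_in_all => q; rewrite mem_primes => /and3P[qp _ qd].
rewrite lognM// logn_prime//.
suff -> : (q == p) = false by rewrite add0n.
by apply/eqP => pq; rewrite -pq qd in pd.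
Qed.

Lemma mobius_sqr (p d : nat) : prime p -> (0 < d)%N -> (p ^ 2 %| d)%N ->
  mobius d = 0.
Proof.
move=> pp d0 pd; rewrite /mobius ifF//; apply/negbTE/allPn; exists p.
  by rewrite mem_primes pp d0 (dvdn_trans _ pd)// dvdn_exp.
by move: pd; rewrite pfactor_dvdn//; case: (logn p d) => [|[]].
Qed.

(** The bound [n < M.+1 ^ k] puts every d with d^k | n inside the range, so the truncated sum is the
    full one. For k-free n only d = 1 survives, since a prime factor p of a larger d would give p^k
    | n. *)
Lemma sum_mobius_pow (k n M : nat) : (0 < k)%N -> (0 < n)%N ->
  (n < M.+1 ^ k)%N ->
  \sum_(1 <= d < M.+1 | (d ^ k %| n)%N) mobius d = (pfree k n)%:R.
Proof.
move=> k0 n0 nM.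
have M0 : (0 < M)%N by case: M nM => //; rewrite exp1n; case: n n0.
have dM d : (d ^ k %| n)%N -> (d < M.+1)%N.
  by move=> /(dvdn_leq n0) dn; rewrite -(@ltn_exp2r _ _ k)//; apply: leq_ltn_trans nM.
case: (boolP (pfree k n)) => [nfree|/pfreePn -/(_ k0 n0)[p [pp pn]]].
  rewrite big_ltn_cond// exp1n dvd1n big_nat_cond big1 ?addr0//.
  move=> d /andP[/andP[d1 _] dn]; exfalso.
  move: nfree; apply/negP/pfreePn => //; exists (pdiv d); split.
    exact: pdiv_prime.
  by apply: dvdn_trans dn; rewrite dvdn_exp2r// pdiv_dvd.
(* The nonzero terms cancel in pairs d <-> p * d with d prime to p. *)
have p0 := prime_gt0 pp.
rewrite (bigID (fun d => p %| d)%N)/=.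
rewrite (bigID (fun d => p ^ 2 %| d)%N)/= big_nat_cond big1 ?add0r; last first.
  by move=> d /andP[/andP[d0 _] /andP[_ ?]]; exact: mobius_sqr pp _ _.
rewrite -big_filter.
set s := [seq d <- index_iota 1 M.+1 | (d ^ k %| n)%N && ~~ (p %| d)%N].
rewrite -[X in _ + X]big_filter -/s.
set t := (X in \sum_(i <- X) _ + _).
(* Here [s] lists the d prime to p and [t] those divisible by p exactly once. Multiplying d in [s]
   by p keeps (p d)^k | n, because p^k and d^k are coprime divisors of n. *)
suff Hp : perm_eq t (map (muln p) s).
  rewrite (perm_big _ Hp)/= big_map [X in X + _]big_seq [X in _ + X]big_seq -big_split/=.
  rewrite big1// => d; rewrite mem_filter mem_index_iota.
  by move=> /andP[/andP[_ pd] /andP[d0 _]]; rewrite mobius_mul_prime// addNr.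
apply: uniq_perm.
- by rewrite filter_uniq// iota_uniq.
- rewrite map_inj_uniq ?filter_uniq ?iota_uniq//.
  by move=> x y /eqP; rewrite eqn_pmul2l// => /eqP.
move=> x; apply/idP/mapP => [|[d + ->]]; rewrite !mem_filter !mem_index_iota.
  move=> /andP[/andP[/andP[xn /dvdnP[d xE]] px] /andP[x0 xM]].
  rewrite mulnC in xE; subst x; exists d => //.
  rewrite mem_filter mem_index_iota.
  move: x0; rewrite muln_gt0 p0/= => d0.
  have pd : ~~ (p %| d)%N by rewrite -(dvdn_pmul2l p0) mulnn.
  have dn : (d ^ k %| n)%N by apply: dvdn_trans xn; rewrite expnMn dvdn_mull.
  by rewrite dn pd d0 dM.
move=> /andP[/andP[dn pd] /andP[d0 _]].
have pdn : ((p * d) ^ k %| n)%N.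
  rewrite expnMn Gauss_dvd ?pn ?dn// coprimeXl// coprimeXr// prime_coprime//.
by rewrite pdn dvdn_mulr// -mulnn dvdn_pmul2l// pd dM// muln_gt0 p0 d0.
Qed.

(** * Sums over multiples and the exact count of k-free integers *)

(** Induction on [N]: the quotient by d grows by one exactly when d divides the new index. The
    codomain is general because both natural and real sums are regrouped this way. *)
Lemma sum_multiples (V : nmodType) (F : nat -> V) (d N : nat) : (0 < d)%N ->
  \sum_(1 <= n < N.+1 | (d %| n)%N) F n =
  \sum_(1 <= e < (N %/ d).+1) F (d * e)%N.
Proof.
move=> d0; elim: N => [|N IH]; first by rewrite div0n !big_geq.
rewrite big_mkcond big_nat_recr//= -big_mkcond IH divnS//.
case: ifP => [dN|]; last by rewrite addr0 add0n.
rewrite add1n [in RHS]big_nat_recr//=; congr (_ + F _).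
by rewrite -[in LHS](divnK dN) divnS// dN mulnC add1n.
Qed.

Lemma count_multiples (d N : nat) : (0 < d)%N ->
  (\sum_(1 <= n < N.+1) (d %| n) = N %/ d)%N.
Proof.
move=> d0; rewrite -big_mkcond/= (@sum_multiples _ (fun=> 1%N))//.
by rewrite sum_nat_const_nat muln1 subn1.
Qed.

Definition nb_pfree (k N : nat) : nat := (\sum_(1 <= n < N.+1) pfree k n)%N.

(** One cut-off M serves all n <= N, so [sum_mobius_pow] can be summed over n and the two sums
    exchanged. *)
Lemma nb_pfreeE (k N M : nat) : (0 < k)%N -> (N < M.+1 ^ k)%N ->
  (nb_pfree k N)%:Z = \sum_(1 <= d < M.+1) mobius d * (N %/ d ^ k)%:Z.
Proof.
move=> k0 NM; rewrite /nb_pfree.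
transitivity (\sum_(1 <= n < N.+1)
   \sum_(1 <= d < M.+1) mobius d * ((d ^ k %| n)%N : nat)%:Z).
  rewrite -[LHS]natz natr_sum; apply: eq_big_nat => n /andP[n0 nN].
  rewrite -(@sum_mobius_pow k n M)//; last exact: leq_ltn_trans NM.
  rewrite big_mkcond; apply: eq_bigr => d _.
  by case: ifP => _; rewrite ?mulr1 ?mulr0.
rewrite exchange_big; apply: eq_big_nat => d /andP[d0 _].
by rewrite -mulr_sumr -(@count_multiples _ N) ?expn_gt0 ?d0// -[in RHS]natz natr_sum;
  congr (_ * _); apply: eq_bigr => n _; rewrite natz.
Qed.

(** * Partial sums of zeta(k) and of the Möbius series for 1/zeta(k) *)

Definition zeta_sum (R : realType) (k M : nat) : R :=
  \sum_(1 <= n < M.+1) n%:R ^- k.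

Definition mobius_sum (R : realType) (k M : nat) : R :=
  \sum_(1 <= d < M.+1) (mobius d)%:~R * d%:R ^- k.

(** For n > T, the term n^-(k+2) is at most T^-k (1/(n-1) - 1/n), and these bounds telescope. *)
Lemma zeta_sum_tail (R : realType) (k T M : nat) : (0 < T)%N -> (T <= M)%N ->
  zeta_sum R k.+2 M - zeta_sum R k.+2 T <= T%:R ^- k.+1.
Proof.
move=> T0 TM; have T0' : 0 < T%:R :> R by rewrite ltr0n.
(* Keeping the subtracted end of the telescoping sum is what makes the induction on [M] work. *)
suff : zeta_sum R k.+2 M - zeta_sum R k.+2 T <= T%:R ^- k.+1 - T%:R ^- k * M%:R^-1.
  by move=> /le_trans; apply; rewrite gerBl mulr_ge0// ?invr_ge0// exprn_ge0// ltW.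
rewrite -(subnK TM); elim: (M - T)%N => [|i IH].
  by rewrite add0n subrr -invfM -exprSr subrr.
rewrite addSn; set m := (i + T)%N in IH *.
have m0 : 0 < m%:R :> R by rewrite ltr0n /m addn_gt0 T0 orbT.
rewrite {1}/zeta_sum big_nat_recr//= -/(zeta_sum R k.+2 m) -natr1.
rewrite addrAC.
apply: le_trans (lerD IH (lexx _)) _.
rewrite -addrA lerD2l addrC lerBlDr [leRHS]addrC.
have Tm : T%:R <= m%:R + 1 :> R by rewrite natr1 ler_nat leqW// /m leq_addl.
have -> : (m%:R + 1 : R) ^- k.+2 = (m%:R + 1) ^- k * (m%:R + 1)^-2.
  by rewrite -invfM -exprD addn2.
apply: (@le_trans _ _ (T%:R ^- k * (m%:R^-1 - (m%:R + 1)^-1))); last first.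
  by rewrite mulrBr.
apply: ler_pM.
- by rewrite invr_ge0 exprn_ge0// addr_ge0// ltW.
- by rewrite invr_ge0 exprn_ge0// addr_ge0// ltW.
- by rewrite lef_pV2 ?posrE ?exprn_gt0// ?addr_gt0// lerXn2r// nnegrE ?addr_ge0// ltW.
- have -> : m%:R^-1 - (m%:R + 1)^-1 = (m%:R * (m%:R + 1))^-1 :> R.
    by field; rewrite !gt_eqF// addr_gt0.
  rewrite lef_pV2 ?posrE ?exprn_gt0// ?mulr_gt0// ?addr_gt0//.
  by rewrite expr2 ler_pM2r ?addr_gt0// lerDl.
Qed.

Lemma zeta_sum_homo (R : realType) (k T M : nat) : (T <= M)%N ->
  zeta_sum R k T <= zeta_sum R k M.
Proof.
move=> TM; rewrite /zeta_sum [leRHS](big_cat_nat (n := T.+1))//= lerDl.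
by apply: sumr_ge0 => i _; rewrite invr_ge0 exprn_ge0.
Qed.

Lemma zeta_sum_ge1 (R : realType) (k M : nat) : (0 < M)%N -> 1 <= zeta_sum R k M.
Proof.
move=> M0; apply: le_trans (zeta_sum_homo R k M0).
by rewrite /zeta_sum big_nat1 expr1n invr1.
Qed.

Lemma zeta_sum_le2 (R : realType) (k M : nat) : zeta_sum R k.+2 M <= 2.
Proof.
case: M => [|M]; first by rewrite /zeta_sum big_geq.
have := @zeta_sum_tail R k 1 M.+1 isT isT.
by rewrite {2}/zeta_sum big_nat1 !expr1n invr1; lra.
Qed.

Lemma series_zetaE (R : realType) (k : nat) :
  series (fun n : nat => (n.+1%:R : R) `^ (- k%:R)) = zeta_sum R k.
Proof.
apply/funext => M; rewrite /series/= /zeta_sum big_add1/=.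
by apply: eq_bigr => i _; rewrite powRN powR_mulrn.
Qed.

Lemma zeta_sum_cvg (R : realType) (k : nat) : cvgn (zeta_sum R k.+2).
Proof.
apply: nondecreasing_is_cvgn; first by move=> T M; exact: zeta_sum_homo.
by exists 2 => _ [M _ <-]; exact: zeta_sum_le2.
Qed.

Lemma zeta_sum_le_zeta (R : realType) (k M : nat) :
  zeta_sum R k.+2 M <= zeta (k.+2%:R : R).
Proof.
rewrite /zeta series_zetaE; apply: nondecreasing_cvgn_le.
  by move=> ? ?; exact: zeta_sum_homo.
exact: zeta_sum_cvg.
Qed.

Lemma zeta_le_zeta_sum (R : realType) (k M : nat) : (0 < M)%N ->
  zeta (k.+2%:R : R) <= zeta_sum R k.+2 M + M%:R ^- k.+1.
Proof.
move=> M0; rewrite /zeta series_zetaE.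
apply: limr_le; first exact: zeta_sum_cvg.
near=> n; rewrite addrC -lerBlDr; apply: zeta_sum_tail => //.
by near: n; exact: nbhs_infty_ge.
Unshelve. all: by end_near. Qed.

Lemma zeta_ge1 (R : realType) (k : nat) : 1 <= zeta (k.+2%:R : R).
Proof. exact: le_trans (zeta_sum_ge1 R k.+2 (ltn0Sn 0)) (zeta_sum_le_zeta R k 1). Qed.

Lemma normr_mobius_int (R : realType) (d : nat) : `|(mobius d)%:~R : R| <= 1.
Proof. by rewrite -intr_norm -[leRHS]/(1%:~R) ler_int normr_mobius. Qed.

Lemma normr_mobius_term (R : realType) (k d : nat) :
  `|(mobius d)%:~R * d%:R ^- k : R| <= d%:R ^- k.
Proof.
rewrite normrM [X in _ * X]ger0_norm ?invr_ge0 ?exprn_ge0//.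
by rewrite ler_piMl ?invr_ge0 ?exprn_ge0// normr_mobius_int.
Qed.

Lemma mobius_sum_tail (R : realType) (k T M : nat) : (0 < T)%N -> (T <= M)%N ->
  `|mobius_sum R k.+2 M - mobius_sum R k.+2 T| <= T%:R ^- k.+1.
Proof.
move=> T0 TM; apply: le_trans (zeta_sum_tail R k T0 TM).
rewrite /mobius_sum /zeta_sum (big_cat_nat (n := T.+1))//=.
rewrite [X in _ <= X - _](big_cat_nat (n := T.+1))//= !(addrC (\sum_(1 <= i < _) _)) !addrK.
apply: le_trans (ler_norm_sum _ _ _) _; apply: ler_sum => d _.
exact: normr_mobius_term.
Qed.

Lemma normr_mobius_sum (R : realType) (k M : nat) : `|mobius_sum R k.+2 M| <= 2.
Proof.
apply: le_trans (zeta_sum_le2 R k M).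
apply: le_trans (ler_norm_sum _ _ _) _; apply: ler_sum => d _.
exact: normr_mobius_term.
Qed.

Lemma pfree1 (n : nat) : (0 < n)%N -> pfree 1 n = (n == 1%N).
Proof.
move=> n0; apply/idP/eqP => [|->//]; apply: contraTeq => n1.
apply/pfreePn => //; exists (pdiv n); rewrite expn1 pdiv_dvd pdiv_prime//.
by case: n n0 n1 => [|[]].
Qed.

(** A finite form of the product of the two Dirichlet series: grouping the pairs (d, e) by n = d e
    <= M leaves the sum of mu(d) over d | n, which vanishes unless n = 1. *)
Lemma mobius_hyperbola (R : realType) (k M : nat) : (0 < M)%N ->
  \sum_(1 <= d < M.+1) (mobius d)%:~R * d%:R ^- k * zeta_sum R k (M %/ d) = 1.
Proof.
move=> M0.
transitivity (\sum_(1 <= d < M.+1) \sum_(1 <= n < M.+1 | (d %| n)%N)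
    (mobius d)%:~R * n%:R ^- k : R).
  apply: eq_big_nat => d /andP[d0 _]; rewrite sum_multiples//.
  rewrite /zeta_sum mulr_sumr; apply: eq_bigr => e _.
  by rewrite natrM exprMn invfM mulrA.
rewrite (exchange_big_dep xpredT)//=.
(* The divisor sum of mu is the case k = 1 of [sum_mobius_pow], and only n = 1 is 1-free. *)
transitivity (\sum_(1 <= n < M.+1) (pfree 1 n)%:R * n%:R ^- k : R).
  apply: eq_big_nat => n /andP[n0 nM]; rewrite -mulr_suml; congr (_ * _).
  have := @sum_mobius_pow 1 n M isT n0; rewrite expn1 => /(_ nM) E.
  rewrite -[RHS](rmorph_nat intr) -E rmorph_sum/=.
  by apply: eq_bigl => d; rewrite expn1.
rewrite big_ltn// expr1n invr1 mulr1 pfree1// big_nat_cond big1 ?addr0//.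
move=> n /andP[/andP[n1 _] _]; rewrite pfree1 ?(ltn_trans _ n1)//.
by rewrite gtn_eqF// mul0r.
Qed.

(** A crude bound that avoids logarithms. With t and s the roots of M + 1 and M, the inductive step
    is 1/t^2 <= 2 (t - s) = 2/(t + s), true since s <= t and t >= 1. *)
Lemma harmonic_le_sqrt (R : realType) (M : nat) :
  \sum_(1 <= d < M.+1) (d%:R : R)^-1 <= 2 * Num.sqrt M%:R.
Proof.
elim: M => [|M IH]; first by rewrite big_geq// sqrtr0 mulr0.
rewrite big_nat_recr//=; apply: le_trans (lerD IH (lexx _)) _.
have tE : M.+1%:R = Num.sqrt M.+1%:R ^+ 2 :> R by rewrite sqr_sqrtr.
have sE : M%:R = Num.sqrt M%:R ^+ 2 :> R by rewrite sqr_sqrtr.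
have E : (M.+1%:R : R) = M%:R + 1 by rewrite natr1.
have t1 : 1 <= Num.sqrt M.+1%:R :> R by rewrite -[leLHS]sqrtr1 ler_wsqrtr// ler1n.
have st : Num.sqrt M%:R <= Num.sqrt M.+1%:R :> R by rewrite ler_wsqrtr// ler_nat.
have s0 : 0 <= Num.sqrt M%:R :> R := sqrtr_ge0 _.
rewrite [X in _ + X^-1]tE.
rewrite [X in X = _]tE [X in _ = X + _]sE in E.
move: t1 st s0 E; clear; set t := Num.sqrt M.+1%:R; set s := Num.sqrt M%:R.
move=> t1 st s0 E.
rewrite -lerBrDl -mulrBr -div1r ler_pdivrMr ?exprn_gt0//; last lra.
have : (t - s) * (t + s) = 1 by rewrite -subr_sqr E addrAC subrr add0r.
nra.
Qed.

(** Subtracting [mobius_hyperbola] leaves, for each d, a tail of zeta starting at M/d. The d-th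
    difference is at most 2/(M d), and the harmonic sum over d is then bounded by a square root. *)
Lemma mobius_zeta_sum_close (R : realType) (k M : nat) : (0 < M)%N ->
  `|mobius_sum R k.+2 M * zeta_sum R k.+2 M - 1| <= 4 / Num.sqrt M%:R.
Proof.
move=> M0; rewrite -[X in _ - X](mobius_hyperbola R k.+2 M0).
rewrite /mobius_sum mulr_suml -sumrB.
have M0' : 0 < M%:R :> R by rewrite ltr0n.
apply: (@le_trans _ _ (\sum_(1 <= d < M.+1) 2 / M%:R * (d%:R : R)^-1)); last first.
  rewrite -mulr_sumr; apply: le_trans (ler_wpM2l _ (harmonic_le_sqrt R M)) _.
    by rewrite divr_ge0.
  have : M%:R = Num.sqrt M%:R ^+ 2 :> R by rewrite sqr_sqrtr.
  have : 0 < Num.sqrt M%:R :> R by rewrite sqrtr_gt0.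
  move: (Num.sqrt _) => s s0 ->; rewrite le_eqVlt; apply/orP; left; apply/eqP.
  by field; rewrite gt_eqF.
apply: le_trans (ler_norm_sum _ _ _) _; apply: ler_sum_nat => d /andP[d0 dM].
have d0' : 0 < d%:R :> R by rewrite ltr0n.
have T0 : (0 < M %/ d)%N by rewrite divn_gt0.
rewrite -mulrBr normrM [X in _ * X]ger0_norm; last first.
  by rewrite subr_ge0 zeta_sum_homo// leq_div.
have -> : 2 / M%:R * d%:R^-1 = d%:R ^- 2 * (2 * d%:R / M%:R) :> R.
  by field; rewrite !gt_eqF.
apply: ler_pM => //.
- by rewrite subr_ge0 zeta_sum_homo// leq_div.
- apply: le_trans (normr_mobius_term R k.+2 d) _.
  by rewrite lef_pV2 ?posrE ?exprn_gt0// ler_weXn2l ?ler1n.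
(* With T = [M %/ d], the tail is at most 1/T, and M < d (T + 1) <= 2 d T. *)
- apply: le_trans (zeta_sum_tail R k T0 (leq_div _ _)) _.
  have T1 : 1 <= (M %/ d)%:R :> R by rewrite ler1n.
  have T0' : 0 < (M %/ d)%:R :> R by rewrite ltr0n.
  apply: (@le_trans _ _ ((M %/ d)%:R^-1)).
    by rewrite lef_pV2 ?posrE ?exprn_gt0// ler_eXnr.
  rewrite -[leLHS]div1r ler_pdivrMr// mulrAC ler_pdivlMr// mul1r -!natrM ler_nat.
  have := ltn_ceil M d0; rewrite mulSn => H.
  have : (d <= d * (M %/ d))%N by rewrite leq_pmulr.
  by lia.
Qed.

Lemma mobius_sum_zeta_close (R : realType) (k M : nat) : (0 < M)%N ->
  `|mobius_sum R k.+2 M - 1 / zeta (k.+2%:R : R)| <= 6 / Num.sqrt M%:R.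
Proof.
move=> M0; have z1 := zeta_ge1 R k; set z := zeta _ in z1 *.
have z0 : 0 < z by apply: lt_le_trans z1.
set S := mobius_sum _ _ _.
(* Dividing by z costs nothing because z >= 1. The constant 6 is 2, from replacing z by its partial
   sum, plus 4 from [mobius_zeta_sum_close]. *)
suff H : `|S * z - 1| <= 6 / Num.sqrt M%:R.
  apply: le_trans H.
  have -> : S * z - 1 = (S - 1 / z) * z by field; rewrite gt_eqF.
  by rewrite normrM (ger0_norm (ltW z0)) ler_peMr.
have -> : S * z - 1 = S * (z - zeta_sum R k.+2 M) + (S * zeta_sum R k.+2 M - 1) by ring.
apply: le_trans (ler_normD _ _) _.
have -> : 6 / Num.sqrt M%:R = 2 / Num.sqrt M%:R + 4 / Num.sqrt M%:R :> R.
  by rewrite -mulrDl -natrD.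
apply: lerD; last exact: mobius_zeta_sum_close.
rewrite normrM; apply: ler_pM => //; first exact: normr_mobius_sum.
rewrite ger0_norm ?subr_ge0 ?zeta_sum_le_zeta//.
apply: (@le_trans _ _ (M%:R ^- k.+1)); first by rewrite lerBlDl zeta_le_zeta_sum.
have M1 : 1 <= M%:R :> R by rewrite ler1n.
have M0' : 0 < M%:R :> R by rewrite ltr0n.
rewrite lef_pV2 ?posrE ?exprn_gt0 ?sqrtr_gt0//.
apply: (@le_trans _ _ M%:R); last by rewrite ler_eXnr.
rewrite -{2}(@sqr_sqrtr _ M%:R)// ler_eXnr//.
by rewrite -[leLHS]sqrtr1 ler_wsqrtr.
Qed.

Lemma mobius_sum_zeta (R : realType) (k M : nat) : (0 < M)%N ->
  `|mobius_sum R k.+2 M - 1 / zeta (k.+2%:R : R)| <= M%:R ^- k.+1.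
Proof.
(* The partial sums are Cauchy with the claimed rate, so the weaker rate of
   [mobius_sum_zeta_close] is only needed to identify their limit. *)
move=> M0; apply/ler_addgt0Pr => e e0.
(* Large enough that the error 6 / sqrt m at [m] is at most [e]. *)
pose m := maxn M (Num.truncn ((6 / e) ^+ 2)).+1.
have Mm : (M <= m)%N by rewrite leq_maxl.
have m0 : (0 < m)%N by apply: leq_trans Mm.
have em : 6 / Num.sqrt m%:R <= e.
  have e6 : 0 < 6 / e by rewrite divr_gt0.
  rewrite ler_pdivrMr ?sqrtr_gt0 ?ltr0n// -ler_pdivrMl// mulrC.
  rewrite -(ger0_norm (ltW e6)) -sqrtr_sqr ler_wsqrtr//.
  have /andP[_ /ltW] := truncn_itv (sqr_ge0 (6 / e)).
  by move=> /le_trans; apply; rewrite ler_nat leq_maxr.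
rewrite -(subrKA (mobius_sum R k.+2 m)).
apply: le_trans (ler_normD _ _) _; apply: lerD.
  by rewrite distrC; exact: mobius_sum_tail.
exact: le_trans (mobius_sum_zeta_close R k m0) em.
Qed.

(** * Asymptotic count of k-free integers *)

Lemma nb_pfree_le (R : realType) (k N : nat) : (0 < N)%N ->
  `|(nb_pfree k.+2 N)%:R - N%:R / zeta (k.+2%:R : R)|
    <= (1 + 2 ^+ k.+2) * N%:R `^ (k.+2%:R^-1).
Proof.
move=> N0; set y := N%:R `^ _; pose M := Num.truncn y.
have y0 : 0 <= y by exact: powR_ge0.
have yk : y ^+ k.+2 = N%:R.
  by rewrite -powR_mulrn// -powRrM mulVf ?pnatr_eq0// powRr1.
have y1 : 1 <= y.
  by rewrite -(@ler_pXn2r _ k.+2) ?nnegrE// yk expr1n ler1n.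
have M0 : (0 < M)%N by rewrite truncn_gt0.
have /andP[My yM] := truncn_itv y0; rewrite -/M in My yM.
have NM : (N < M.+1 ^ k.+2)%N.
  by rewrite -(ltr_nat R) natrX -yk ltrXn2r// ?ltW.
pose S := mobius_sum R k.+2 M.
have M0' : 0 < M%:R :> R by rewrite ltr0n.
(* Removing the floor from N / d^(k+2) costs at most 1 for each of the M values of d. *)
have H1 : `|(nb_pfree k.+2 N)%:R - N%:R * S| <= M%:R.
  have -> : (nb_pfree k.+2 N)%:R =
      \sum_(1 <= d < M.+1) (mobius d)%:~R * (N %/ d ^ k.+2)%:R :> R.
    rewrite -[LHS]/((nb_pfree k.+2 N)%:Z%:~R) (nb_pfreeE _ NM)// rmorph_sum/=.
    by apply: eq_bigr => d _; rewrite rmorphM.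
  rewrite /S /mobius_sum mulr_sumr -sumrB.
  apply: le_trans (ler_norm_sum _ _ _) _.
  apply: (@le_trans _ _ (\sum_(1 <= d < M.+1) 1)); last first.
    by rewrite sumr_const_nat subn1.
  apply: ler_sum_nat => d /andP[d0 dM]; rewrite mulrCA -mulrBr normrM.
  have d0' : 0 < (d ^ k.+2)%:R :> R by rewrite ltr0n expn_gt0 d0.
  rewrite -[leRHS]mulr1 ler_pM ?normr_mobius_int// ler_norml -natrX.
  have hi : (N %/ d ^ k.+2)%:R <= N%:R / (d ^ k.+2)%:R :> R.
    by rewrite ler_pdivlMr// -natrM ler_nat leq_trunc_div.
  have lo : N%:R / (d ^ k.+2)%:R < (N %/ d ^ k.+2)%:R + 1 :> R.
    by rewrite ltr_pdivrMr// natr1 -natrM ltr_nat ltn_ceil// expn_gt0 d0.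
  by apply/andP; split; lra.
(* Completing the Möbius series costs N / M^(k+1), and N < (M + 1)^(k+2) <= (2 M)^(k+2). *)
have H2 : `|N%:R * S - N%:R / zeta (k.+2%:R : R)| <= 2 ^+ k.+2 * M%:R.
  have -> : N%:R * S - N%:R / zeta k.+2%:R = N%:R * (S - 1 / zeta k.+2%:R).
    by rewrite mulrBr mulrA mulr1.
  rewrite normrM ger0_norm//.
  apply: le_trans (ler_wpM2l _ (mobius_sum_zeta R k M0)) _ => //.
  rewrite ler_pdivrMr ?exprn_gt0// -mulrA -exprS -exprMn -natrM -natrX.
  rewrite ler_nat; apply: leq_trans (ltnW NM) _.
  by rewrite leq_exp2r// mul2n -addnn -addn1 leq_add2l.
rewrite -(subrKA (N%:R * S)); apply: le_trans (ler_normD _ _) _.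
rewrite mulrDl mul1r; apply: lerD; first exact: le_trans H1 My.
by apply: le_trans H2 _; rewrite ler_pM2l ?exprn_gt0.
Qed.

(** * From one-parameter families of curves to counts of integers *)

Lemma card_signed_image (T : choiceType) (f : int -> T) (P : pred nat) (N : nat) :
  injective f ->
  #|` fset_set [set f d | d in [set d : int |
        [/\ d != 0, (`|d| <= N)%N & P `|d|%N]]]|%fset
  = (2 * \sum_(1 <= n < N.+1) P n)%N.
Proof.
move=> finj.
pose s := [seq n <- index_iota 1 N.+1 | P n].
pose l := [seq f n%:Z | n <- s] ++ [seq f (- n%:Z) | n <- s].
have us : uniq s by rewrite filter_uniq// iota_uniq.
have ul : uniq l.
  (* The positive and negative halves are disjoint because [s] starts at 1, so n = -m is
     impossible. *)
  rewrite cat_uniq !map_inj_uniq ?us//=; last 2 first.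
  - by move=> x y /finj /oppr_inj [].
  - by move=> x y /finj [].
  rewrite andbT; apply/hasPn => _ /mapP[n ns ->]; apply/mapP => -[m ms /finj].
  by move: ns; rewrite mem_filter mem_index_iota; lia.
have inl x : (x \in [fset x in l]%fset) =
    (x \in [seq f n%:Z | n <- s]) || (x \in [seq f (- n%:Z) | n <- s]).
  by rewrite in_fset mem_cat.
have -> : [set f d | d in [set d : int | [/\ d != 0, (`|d| <= N)%N & P `|d|%N]]]
    = [set` [fset x in l]%fset].
  apply/seteqP; split=> [_ [d [d0 dN Pd] <-]|x] /=; rewrite inl.
    have ds : `|d|%N \in s by rewrite mem_filter Pd mem_index_iota; lia.
    have [d1|d1] := leP 0 d; apply/orP; [left|right]; apply/mapP; exists `|d|%N => //;
      congr f; lia.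
  have ns n : n \in s -> [/\ n != 0, (n <= N)%N & P n].
    by rewrite mem_filter mem_index_iota => /andP[? ?]; split=> //; lia.
  case/orP => /mapP[n /ns[n0 nN Pn] ->]; [exists n%:Z|exists (- n%:Z)] => //=;
    rewrite ?abszN absz_nat; split=> //; lia.
rewrite set_fsetK card_fseq undup_id// size_cat !size_map addnn -mul2n; congr (_ * _)%N.
by rewrite size_filter -sum1_count big_mkcond/=; apply: eq_bigr => n _; case: (P n).
Qed.

(** The common core of the three cases. Both counts run over 0 < |d| <= N with N the floor of
    (X/C)^(1/(r+1)), so the factor 2 for the sign of d cancels and [nb_pfree_le] estimates the
    quotient. *)
Lemma nearO_ratio (R : realType) (alpha beta C : R) (j : rat) (f : int -> curve)
    (k r : nat) :
  0 < C -> injective f ->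
  (forall E, with_jinv all_curves j E <-> exists2 d : int, d != 0 & E = f d) ->
  (forall d : int, d != 0 -> (minimal_curves (f d) <-> pfree k.+2 `|d|)) ->
  (forall d, height alpha beta (f d) = C * `|d|%:R ^+ r.+1) ->
  (fun X : R => (count (with_jinv minimal_curves j) alpha beta X)%:R /
     (count (with_jinv all_curves j) alpha beta X)%:R) =
  cst (1 / zeta k.+2%:R) +O_ +oo
    (fun X : R => X `^ (- ((1 - k.+2%:R^-1) / r.+1%:R))).
Proof.
move=> C0 finj allE minE heightE.
pose y (X : R) : R := (X / C) `^ r.+1%:R^-1.
have yr X : 0 <= X -> y X ^+ r.+1 = X / C.
  move=> X0; rewrite -powR_mulrn ?powR_ge0// -powRrM mulVf ?pnatr_eq0// powRr1//.
  by rewrite divr_ge0// ltW.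
pose N (X : R) := Num.truncn (y X).
have heightP X d : 0 <= X -> (height alpha beta (f d) <= X) = (`|d| <= N X)%N.
  move=> X0; rewrite heightE mulrC -ler_pdivlMr// -yr// ler_pXn2r ?nnegrE ?powR_ge0//.
  by rewrite truncn_ge_nat ?powR_ge0.
(* Used with [pfree k.+2] for the numerator and with [xpredT] for the denominator. *)
have countE (F : set curve) (P : pred nat) X : 0 <= X -> (forall E, F E -> all_curves E) ->
    (forall d : int, d != 0 -> (F (f d) <-> P `|d|%N)) ->
    count (with_jinv F j) alpha beta X = (2 * \sum_(1 <= n < (N X).+1) P n)%N.
  move=> X0 Fall FP; rewrite /count -(card_signed_image P (N X) finj).
  congr (#|` fset_set _|)%fset; apply/seteqP; split=> [E [[FE Ej] hE]|_ [d [d0 dN Pd] <-]].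
    have [d d0 EE] := (allE E).1 (conj (Fall E FE) Ej).
    exists d; last by rewrite EE.
    have FfD : F (f d) by rewrite -EE.
    have dN : (`|d| <= N X)%N by rewrite -(heightP X d X0) -EE; exact: hE.
    exact: And3 d0 dN ((FP d d0).1 FfD).
  have [_ fj] := (allE (f d)).2 (ex_intro2 _ _ d d0 erefl).
  by split; [split; [exact: (FP d d0).2|exact: fj]|rewrite (heightP X d X0)].
have z1 := zeta_ge1 R k.
set a : R := 1 - k.+2%:R^-1.
have a0 : 0 <= a by rewrite subr_ge0 invf_le1 ?ltr0n// ler1n.
(* The first factor comes from [nb_pfree_le]; the second is the price of passing from N to X, as X =
   C y^(r+1) and y <= 2 N. *)
pose K : R := (1 + 2 ^+ k.+2) * (C `^ (a / r.+1%:R) * 2 `^ a).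
apply/eqaddOP/bigO_exP; exists K.
  by rewrite /K !mulr_gt0 ?powR_gt0// addr_gt0// exprn_gt0.
near=> X.
(* From X = C on, y >= 1 and hence N >= 1, so the denominator of the ratio is nonzero. *)
have XC : C <= X by near: X; apply: nbhs_pinfty_ge; exact: num_real.
have X0 : 0 < X by apply: lt_le_trans XC.
have y1 : 1 <= y X.
  rewrite -(@ler_pXn2r _ r.+1) ?nnegrE ?powR_ge0// expr1n (yr X (ltW X0)).
  by rewrite ler_pdivlMr// mul1r.
have y0 : 0 < y X by apply: lt_le_trans y1.
have N0 : (0 < N X)%N by rewrite truncn_gt0.
have N0' : 0 < (N X)%:R :> R by rewrite ltr0n.
have yN : y X <= 2 * (N X)%:R.
  have /andP[_ /ltW/le_trans] := truncn_itv (ltW y0); apply.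
  by rewrite -natrM ler_nat mul2n -addnn -addn1 leq_add2l.
have XN : X `^ (a / r.+1%:R) <= C `^ (a / r.+1%:R) * 2 `^ a * (N X)%:R `^ a.
  have {1}-> : X = C * y X ^+ r.+1 by rewrite yr ?ltW// mulrC divfK// gt_eqF.
  rewrite (powRM _ (ltW C0) (exprn_ge0 _ (ltW y0))) -mulrA ler_pM2l ?powR_gt0//.
  rewrite -(powR_mulrn _ (ltW y0)) -powRrM mulrC divfK ?pnatr_eq0//.
  rewrite -powRM//.
  by apply: ge0_ler_powR; rewrite ?nnegrE ?mulr_ge0//; exact: ltW.
rewrite !fctE (countE minimal_curves (pfree k.+2) X (ltW X0))//; last by move=> E [].
rewrite (countE all_curves xpredT X (ltW X0))//; last first.
  by move=> d d0; split=> // _; exact: ((allE (f d)).2 (ex_intro2 _ _ d d0 erefl)).1.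
rewrite sum_nat_const_nat muln1 subn1/= -/(nb_pfree k.+2 (N X)).
rewrite !natrM -mulf_div divff ?pnatr_eq0// mul1r.
rewrite (ger0_norm (powR_ge0 _ _)) powRN.
set Q := (nb_pfree _ _)%:R.
have -> : (Q / (N X)%:R - 1 / zeta k.+2%:R) = (Q - (N X)%:R / zeta k.+2%:R) / (N X)%:R.
  by field; rewrite !gt_eqF// (lt_le_trans _ z1).
rewrite normrM normfV (ger0_norm (ltW N0')).
rewrite ler_pdivrMr// mulrAC ler_pdivlMr ?powR_gt0//.
have c0 : 0 < 1 + 2 ^+ k.+2 :> R by rewrite addr_gt0 ?exprn_gt0.
apply: le_trans (ler_wpM2r (powR_ge0 _ _) (nb_pfree_le R k N0)) _.
(* An error of order N^(1/(k+2)), once divided by N, is of order N^-a. *)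
have NE : (N X)%:R = (N X)%:R `^ k.+2%:R^-1 * (N X)%:R `^ a.
  rewrite -powRD; last by rewrite (gt_eqF N0') implybT.
  by rewrite /a addrCA subrr addr0 powRr1.
rewrite /K [in leRHS]NE mulrACA ler_wpM2l// mulr_ge0 ?powR_ge0//.
Unshelve. all: by end_near.
Qed.

(** * Equations for the curves of given j-invariant *)

Lemma mul_div_eqP (F : fieldType) (c a D j : F) :
  (D != 0 /\ c * (a / D) = j) <-> (D != 0 /\ c * a = j * D).
Proof.
by split=> -[D0 h]; split=> //; rewrite ?mulrA ?h ?mulfK// -h mulrA divfK.
Qed.

Lemma disc_neq0 (E : curve) :
  (disc E != 0) = (4 * E.1%:~R ^+ 3 + 27 * E.2%:~R ^+ 2 != 0 :> rat).
Proof.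
(* The test whether -16 is zero evaluates to [false]. *)
rewrite /disc mulf_eq0 -[X in X || _]/false orFb -(intr_eq0 rat).
by rewrite rmorphD !rmorphM.
Qed.

Lemma with_jinvP (j : rat) (E : curve) : with_jinv all_curves j E <->
  (4 * E.1%:~R ^+ 3 + 27 * E.2%:~R ^+ 2 != 0 :> rat) /\
  1728 * (4 * E.1%:~R ^+ 3) = j * (4 * E.1%:~R ^+ 3 + 27 * E.2%:~R ^+ 2).
Proof.
rewrite /with_jinv /all_curves /mkset disc_neq0 /jinv.
exact: mul_div_eqP.
Qed.

Lemma minimal_curvesP (j : rat) (E : curve) : with_jinv all_curves j E ->
  minimal_curves E <->
  ~ exists p, [/\ prime p, (p ^ 4 %| `|E.1|)%N & (p ^ 6 %| `|E.2|)%N].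
Proof.
have H (p : nat) (k : nat) (x : int) : (p%:Z ^+ k %| x)%Z = (p ^ k %| `|x|)%N.
  by rewrite dvdzE abszX.
case=> allE _; split=> [[_ nE]|nE]; last (split; first exact: allE).
  by case=> p [pp h4 h6]; apply: nE; exists p; rewrite !H.
by case=> p [pp]; rewrite !H => h4 h6; apply: nE; exists p.
Qed.

Lemma jinv0_eqP (F : realFieldType) (a b : F) :
  (4 * a ^+ 3 + 27 * b ^+ 2 != 0 /\
   1728 * (4 * a ^+ 3) = 0 * (4 * a ^+ 3 + 27 * b ^+ 2)) <-> (a = 0 /\ b != 0).
Proof.
split=> [[D0 h]|[-> b0]]; last first.
  by rewrite expr0n !mulr0 add0r mul0r mulf_neq0// ?expf_neq0// pnatr_eq0.
have a0 : a = 0.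
  apply/eqP; suff : a ^+ 3 == 0 by rewrite expf_eq0.
  by apply/eqP; lra.
split=> //.
by apply: contra_neq D0 => ->; rewrite a0 !expr0n !mulr0 addr0.
Qed.

Lemma jinv1728_eqP (F : realFieldType) (a b : F) :
  (4 * a ^+ 3 + 27 * b ^+ 2 != 0 /\
   1728 * (4 * a ^+ 3) = 1728 * (4 * a ^+ 3 + 27 * b ^+ 2)) <-> (b = 0 /\ a != 0).
Proof.
split=> [[D0 h]|[-> a0]]; last first.
  by rewrite expr0n !mulr0 addr0 mulf_neq0// ?expf_neq0// pnatr_eq0.
have b0 : b = 0 by apply/eqP; rewrite -sqrf_eq0; apply/eqP; lra.
split=> //.
by apply: contra_neq D0 => ->; rewrite b0 !expr0n !mulr0 addr0.
Qed.

Lemma jinv_generic_eqP (F : realFieldType) (j a b : F) : j != 1728 ->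
  (4 * a ^+ 3 + 27 * b ^+ 2 != 0 /\
   1728 * (4 * a ^+ 3) = j * (4 * a ^+ 3 + 27 * b ^+ 2)) <->
  (b != 0 /\ 4 * (1728 - j) * a ^+ 3 = 27 * j * b ^+ 2).
Proof.
move=> j1728; have j1 : 1728 - j != 0 by rewrite subr_eq0 eq_sym.
split=> [[D0 e]|[b0 e]].
  have e' : 4 * (1728 - j) * a ^+ 3 = 27 * j * b ^+ 2 by lra.
  split=> //; apply: contra_neq D0 => b0.
  have : (1728 - j) * a ^+ 3 = 0 by rewrite b0 expr0n !mulr0 in e'; lra.
  move/eqP; rewrite mulf_eq0 (negbTE j1) => /eqP ->.
  by rewrite b0 expr0n !mulr0 addr0.
split; last lra.
apply: contra_neq b0 => D0; apply/eqP; rewrite -sqrf_eq0; apply/eqP.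
(* If the denominator vanished, then 27 b^2 = -4 a^3, and by [e] the two summands would cancel,
   forcing b = 0. *)
have h : 1728 * 27 * b ^+ 2 = 27 * j * b ^+ 2 + (1728 - j) * (27 * b ^+ 2) by ring.
have h' : 27 * b ^+ 2 = - (4 * a ^+ 3) by lra.
have : 1728 * 27 * b ^+ 2 = 0 by rewrite h h' -e; ring.
lra.
Qed.

(** An explicit integral curve for j = u/v. It works because 4 * 108^3 = 27 * 432^2 and (1728 - j) u
    = j w. *)
Lemma jinv_generic_witness (F : fieldType) (j : F) (u v : int) :
  let w := 1728 * v - u in
  u%:~R = j * v%:~R ->
  w%:~R = (1728 - j) * v%:~R /\
  4 * (1728 - j) * (108 * u * w)%:~R ^+ 3 =
    27 * j * (432 * u * w ^+ 2)%:~R ^+ 2.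
Proof.
move=> w uE.
have wE : w%:~R = (1728 - j) * v%:~R by rewrite rmorphB rmorphM rmorph_nat/= uE mulrBl.
split=> //; rewrite [X in X ^+ 3]intrM intrM [X in _ = _ * X ^+ 2]intrM (intrM _ 432).
by rewrite !rmorph_nat rmorphXn/= wE uE; ring.
Qed.

Lemma jinv_generic_neq0 (F : numFieldType) (j a b : F) : j != 0 -> b != 0 ->
  4 * (1728 - j) * a ^+ 3 = 27 * j * b ^+ 2 -> a != 0.
Proof.
move=> j0 b0 e; apply: contra_neq b0 => a0; apply/eqP.
move: e; rewrite a0 expr0n mulr0 => /esym/eqP.
by rewrite mulf_eq0 mulf_eq0 (negbTE j0) pnatr_eq0/= sqrf_eq0.
Qed.

Lemma jinv_generic_scale (F : numFieldType) (j a b : F) (d : int) : d != 0 ->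
  4 * (1728 - j) * (a * d%:~R ^+ 2) ^+ 3 = 27 * j * (b * d%:~R ^+ 3) ^+ 2 <->
  4 * (1728 - j) * a ^+ 3 = 27 * j * b ^+ 2.
Proof.
move=> d0; have d0' : d%:~R != 0 :> F by rewrite intr_eq0.
move: d%:~R d0' => {d0} t t0.
have -> : 4 * (1728 - j) * (a * t ^+ 2) ^+ 3 = 4 * (1728 - j) * a ^+ 3 * t ^+ 6 by ring.
have -> : 27 * j * (b * t ^+ 3) ^+ 2 = 27 * j * b ^+ 2 * t ^+ 6 by ring.
by split=> [|->//]; exact: (mulIf (expf_neq0 6 t0)).
Qed.

(** Eliminates j: it determines the ratio of a^3 to b^2. *)
Lemma jinv_generic_cross (F : realFieldType) (j a b a0 b0 : F) : j != 0 ->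
  4 * (1728 - j) * a ^+ 3 = 27 * j * b ^+ 2 ->
  4 * (1728 - j) * a0 ^+ 3 = 27 * j * b0 ^+ 2 ->
  a0 ^+ 3 * b ^+ 2 = a ^+ 3 * b0 ^+ 2.
Proof.
move=> j0 e e0; have j27 : 27 * j != 0 by rewrite mulf_neq0// pnatr_eq0.
by apply: (mulfI j27); rewrite mulrCA -e [RHS]mulrCA -e0; ring.
Qed.

Lemma twist_parameter (F : fieldType) (a b a0 b0 : F) :
  a != 0 -> b != 0 -> a0 != 0 -> b0 != 0 ->
  a0 ^+ 3 * b ^+ 2 = a ^+ 3 * b0 ^+ 2 ->
  exists t, [/\ t != 0, a = a0 * t ^+ 2 & b = b0 * t ^+ 3].
Proof.
(* The quotient of b/b0 = t^3 by a/a0 = t^2 leaves no other choice for t. *)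
move=> an bn a0n b0n cross; exists (b * a0 / (a * b0)); split.
- by rewrite !mulf_neq0// invr_neq0// mulf_neq0.
- have -> : a0 * (b * a0 / (a * b0)) ^+ 2 = (a0 ^+ 3 * b ^+ 2) / (a ^+ 2 * b0 ^+ 2).
    by field; rewrite an b0n.
  by rewrite cross; field; rewrite an b0n.
- have -> : b0 * (b * a0 / (a * b0)) ^+ 3 = (a0 ^+ 3 * b ^+ 2) * b / (a ^+ 3 * b0 ^+ 2).
    by field; rewrite an b0n.
  by rewrite cross; field; rewrite an b0n.
Qed.

Lemma with_jinv0P (E : curve) :
  with_jinv all_curves 0 E <-> exists2 d : int, d != 0 & E = (0, d).
Proof.
apply: iff_trans (with_jinvP _ _) _; apply: iff_trans (jinv0_eqP _ _) _.
case: E => A B; rewrite /fst /snd intr_eq0.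
split=> [[/eqP A0 B0]|[d d0 [-> ->]]]; last by rewrite d0.
by exists B => //; move: A0; rewrite intr_eq0 => /eqP ->.
Qed.

Lemma with_jinv1728P (E : curve) :
  with_jinv all_curves 1728 E <-> exists2 d : int, d != 0 & E = (d, 0).
Proof.
apply: iff_trans (with_jinvP _ _) _; apply: iff_trans (jinv1728_eqP _ _) _.
case: E => A B; rewrite /fst /snd intr_eq0.
split=> [[/eqP B0 A0]|[d d0 [-> ->]]]; last by rewrite d0.
by exists A => //; move: B0; rewrite intr_eq0 => /eqP ->.
Qed.

(** * The twist family for j different from 0 and 1728 *)

Section GenericJ.
Variable j : rat.
Hypotheses (j0 : j != 0) (j1728 : j != 1728).

Lemma with_jinv_genericP (E : curve) : with_jinv all_curves j E <->
  E.2 != 0 /\ 4 * (1728 - j) * E.1%:~R ^+ 3 = 27 * j * E.2%:~R ^+ 2.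
Proof.
rewrite -(intr_eq0 rat).
exact: iff_trans (with_jinvP _ _) (jinv_generic_eqP _ _ j1728).
Qed.

Lemma with_jinv_generic_neq0 (E : curve) : with_jinv all_curves j E -> E.1 != 0.
Proof.
move=> /with_jinv_genericP[B0 e]; rewrite -(intr_eq0 rat).
by apply: jinv_generic_neq0 j0 _ e; rewrite intr_eq0.
Qed.

Lemma with_jinv_generic_ex : exists E, with_jinv all_curves j E.
Proof.
have v0 : (denq j)%:~R != 0 :> rat by rewrite intr_eq0 denq_neq0.
have uE : (numq j)%:~R = j * (denq j)%:~R by rewrite -{2}(divq_num_den j) divfK.
have [wE e] := jinv_generic_witness uE.
have u0 : numq j != 0 by rewrite numq_eq0.
move: (1728 * denq j - numq j) wE e => w wE e.
have j1 : 1728 - j != 0 by rewrite subr_eq0 eq_sym; exact: j1728.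
have w0 : w != 0 by rewrite -(intr_eq0 rat) wE; exact: mulf_neq0 j1 v0.
exists (108 * numq j * w, 432 * numq j * w ^+ 2).
apply: (with_jinv_genericP _).2; split; last exact: e.
by rewrite /snd !mulf_neq0// expf_neq0.
Qed.

Definition twist (E : curve) (d : int) : curve := (E.1 * d ^+ 2, E.2 * d ^+ 3).

Lemma with_jinv_twist (E : curve) (d : int) : d != 0 ->
  with_jinv all_curves j (twist E d) <-> with_jinv all_curves j E.
Proof.
move=> d0; apply: iff_trans (with_jinv_genericP _) _.
apply: iff_trans (iff_sym (with_jinv_genericP _)).
rewrite /twist /fst /snd (intrM _ E.1 (d ^+ 2)) (intrM _ E.2 (d ^+ 3)) !rmorphXn.
have -> : (E.2 * d ^+ 3 != 0) = (E.2 != 0) by rewrite mulf_eq0 expf_eq0 (negbTE d0) orbF.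
have H := jinv_generic_scale j E.1%:~R E.2%:~R d0.
by split=> -[B0 e]; [exact: conj B0 (H.1 e)|exact: conj B0 (H.2 e)].
Qed.

Lemma twist_inj (E : curve) : E.1 != 0 -> E.2 != 0 -> injective (twist E).
Proof.
move=> A0 B0 d e [/(mulfI A0) h2 /(mulfI B0) h3].
have [d0|d0] := eqVneq d 0.
  by move: h2; rewrite d0 expr0n => /esym/eqP; rewrite expf_eq0 => /eqP.
by apply: (mulIf (expf_neq0 2 d0)); rewrite -exprS h3 h2 -exprS.
Qed.

(** The base point of the family. The exponents 2 and 3 are those of [twist], so this is stronger
    than minimality, which concerns p^4 and p^6. *)
Definition primitive_curve (E : curve) := with_jinv all_curves j E /\
  forall n : nat, (n ^ 2 %| `|E.1|)%N -> (n ^ 3 %| `|E.2|)%N -> n = 1%N.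

(* A curve with minimal |B|, since dividing out n lowers |B|. *)
Lemma primitive_curve_ex : exists E, primitive_curve E.
Proof.
pose P n := `[< exists2 E, with_jinv all_curves j E & `|E.2|%N = n >].
have exP : exists n, P n.
  have [E jE] := with_jinv_generic_ex.
  by exists `|E.2|%N; apply/asboolP; exact: ex_intro2 _ _ E jE erefl.
case: (ex_minnP exP) => m /asboolP[[A B] jAB Bm] mP; exists (A, B); split=> // n.
rewrite /= in Bm *; have [B0 _] := (with_jinv_genericP _).1 jAB.
rewrite /= -absz_gt0 Bm in B0.
have dvdZ k (x : int) : (n ^ k %| `|x|)%N -> exists y, x = y * n%:Z ^+ k.
  move=> nx; have : (n%:Z ^+ k %| x)%Z by rewrite dvdzE abszX.
  by move=> /dvdzP.
move=> /dvdZ[a aE] /dvdZ[b bE].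
have n0 : (0 < n)%N by case: n bE B0 {aE dvdZ} => // bE; rewrite -Bm bE expr0n mulr0.
have jab : with_jinv all_curves j (a, b).
  have n0' : n%:Z != 0 by rewrite -lt0n.
  apply: (with_jinv_twist (a, b) n0').1; rewrite /twist /fst /snd -aE -bE.
  exact: jAB.
have : (m <= `|b|)%N by apply: mP; apply/asboolP; exact: ex_intro2 _ _ (a, b) jab erefl.
rewrite -Bm bE abszM abszX absz_nat => h.
have b0 : (0 < `|b|)%N by move: B0; rewrite -Bm bE abszM muln_gt0 => /andP[].
have : (n ^ 3 <= 1)%N by rewrite -(leq_pmul2l b0) muln1.
by case: n {aE bE dvdZ jab h} n0 => [|[|n]].
Qed.

(** Two curves with this j differ by a rational twist t = m/n in lowest terms. Clearing
    denominators, coprimality gives n^2 | A0 and n^3 | B0, so primitivity forces n = 1. *)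
Lemma primitive_curveP (E0 E : curve) : primitive_curve E0 ->
  with_jinv all_curves j E <-> exists2 d : int, d != 0 & E = twist E0 d.
Proof.
move=> [jE0 E0prim]; split=> [jE|[d d0 ->]]; last exact: (with_jinv_twist E0 d0).2.
have := with_jinv_generic_neq0 jE; have := with_jinv_generic_neq0 jE0.
move: jE0 jE => /with_jinv_genericP[B0 e0] /with_jinv_genericP[B e] A0 A.
have rA0 : E0.1%:~R != 0 :> rat by rewrite intr_eq0.
have rB0 : E0.2%:~R != 0 :> rat by rewrite intr_eq0.
have rA : E.1%:~R != 0 :> rat by rewrite intr_eq0.
have rB : E.2%:~R != 0 :> rat by rewrite intr_eq0.
have cross := jinv_generic_cross j0 e e0.
have [t [t0 tA tB]] := twist_parameter rA rB rA0 rB0 cross.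
have n0 : (denq t)%:~R != 0 :> rat by rewrite intr_eq0 denq_neq0.
have tE : t * (denq t)%:~R = (numq t)%:~R by rewrite -{1}(divq_num_den t) divfK.
have cop : coprime `|denq t| `|numq t| by rewrite coprime_sym; exact: coprime_num_den.
have m0 : numq t != 0 by rewrite numq_eq0.
have den_gt0 := denq_gt0 t.
move: (denq t) (numq t) tE cop m0 den_gt0 => {n0} n m tE cop m0 n0.
have clear_denom k (x x0 : int) : x%:~R = x0%:~R * t ^+ k ->
    x * n ^+ k = x0 * m ^+ k.
  move=> xE; apply: (@intr_inj rat).
  by rewrite !rmorphM !rmorphXn/= xE -mulrA -exprMn tE.
have dvd k (x x0 : int) : x * n ^+ k = x0 * m ^+ k -> (`|n| ^ k %| `|x0|)%N.
  move=> h; rewrite -(@Gauss_dvdl _ _ (`|m| ^ k)).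
    by rewrite -!abszX -abszM -h abszM dvdn_mull.
  exact: coprimeXl (coprimeXr _ cop).
have hA := clear_denom _ _ _ tA; have hB := clear_denom _ _ _ tB.
have n1 : n = 1.
  by have := E0prim _ (dvd _ _ _ hA) (dvd _ _ _ hB); move: n0; clear; lia.
exists m; first exact: m0.
rewrite /twist -hA -hB n1 !expr1n !mulr1.
exact: surjective_pairing.
Qed.

(** If p^2 | d then p^4 | d^2 and p^6 | d^3. Conversely, for squarefree d a violation of minimality
    at p would leave p^2 | A0 and p^3 | B0, against primitivity. *)
Lemma minimal_twistP (E0 : curve) (d : int) : primitive_curve E0 -> d != 0 ->
  minimal_curves (twist E0 d) <-> pfree 2 `|d|.
Proof.
move=> E0P d0.
have jE : with_jinv all_curves j (twist E0 d).
  exact: (primitive_curveP _ E0P).2 (ex_intro2 _ _ d d0 erefl).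
have [_ prim] := E0P.
have d0' : (0 < `|d|)%N by rewrite absz_gt0.
rewrite (minimal_curvesP jE) /twist /= (abszM E0.1) (abszM E0.2) !abszX.
move: (`|E0.1|)%N (`|E0.2|)%N (`|d|)%N d0' prim => a b e e0 prim {jE}.
split=> [nE|efree [p [pp h4 h6]]].
  apply: contra_notT nE => /pfreePn -/(_ isT e0) [p [pp pe]]; exists p; split=> //.
    by rewrite dvdn_mull// (expnM p 2 2) dvdn_exp2r.
  by rewrite dvdn_mull// (expnM p 2 3) dvdn_exp2r.
have p0 := prime_gt0 pp.
have pe : ~~ (p ^ 2 %| e)%N.
  by apply/negP => pe; move: efree; apply/negP/pfreePn => //; exists p.
(* Since p divides e at most once, e^k accounts for at most k of the 2k factors p. *)
have strip (k x : nat) : (p ^ (k + k) %| x * e ^ k)%N -> (p ^ k %| x)%N.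
  move=> h; have [/dvdnP[q qE]|pe'] := boolP (p %| e)%N.
    have pq : ~~ (p %| q)%N.
      by apply: contraNN pe; rewrite qE -mulnn dvdn_pmul2r.
    have : (p ^ k %| x * q ^ k)%N.
      by move: h; rewrite qE expnMn mulnA expnD dvdn_pmul2r// expn_gt0 p0.
    by rewrite Gauss_dvdl// coprimeXl// coprimeXr// prime_coprime.
  rewrite -(@Gauss_dvdl _ _ (e ^ k)).
    by apply: dvdn_trans h; rewrite expnD dvdn_mulr.
  by rewrite coprimeXl// coprimeXr// prime_coprime.
have p1 := prim p (strip 2 a h4) (strip 3 b h6).
by rewrite p1 in pp.
Qed.

End GenericJ.

(** * Heights of twists and the three cases of the theorem *)

Lemma height_twist (R : realType) (alpha beta : R) (E : curve) (d : int) :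
  height alpha beta (twist E d) = height alpha beta E * `|d|%:R ^+ 6.
Proof.
rewrite /height maxr_pMl ?exprn_ge0// /twist /fst /snd.
rewrite (intrM _ E.1 (d ^+ 2)) (intrM _ E.2 (d ^+ 3)) !rmorphXn natr_absz intr_norm /=.
move: (E.1%:~R : R) (E.2%:~R : R) (d%:~R : R) => a b t.
congr Num.max; first by rewrite normrM exprMn normrX -exprM mulrA.
have -> : `|t| ^+ 6 = (`|t| ^+ 2) ^+ 3 by rewrite -exprM.
by rewrite real_normK ?num_real//; ring.
Qed.

(** Serves j = 0 and j = 1728, where one coefficient is 0, hence divisible by everything, and the
    other alone decides minimality, with k = 6 or k = 4. *)
Lemma minimal_curves_axisP (j : rat) (E : curve) (k : nat) (d : int) :
    (0 < k)%N -> with_jinv all_curves j E -> d != 0 ->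
    (forall p, ((p ^ 4 %| `|E.1|) && (p ^ 6 %| `|E.2|) = (p ^ k %| `|d|))%N) ->
  minimal_curves E <-> pfree k `|d|.
Proof.
move=> k0 jE d0 dvdE; rewrite (minimal_curvesP jE).
have {}d0 : (0 < `|d|)%N by rewrite absz_gt0.
split=> [nE|dfree [p [pp h4 h6]]].
  apply: contra_notT nE => /pfreePn -/(_ k0 d0)[p [pp]].
  by rewrite -dvdE => /andP[? ?]; exists p.
by move: dfree; apply/negP/pfreePn => //; exists p; rewrite -dvdE h4 h6.
Qed.

Theorem theorem2p11 (R : realType) (alpha beta : R)
    (halpha : 1 <= alpha) (hbeta : 1 <= beta) (j : rat) :
  let ratio (X : R) : R :=
    (count (with_jinv minimal_curves j) alpha beta X)%:R /
    (count (with_jinv all_curves j) alpha beta X)%:R in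
  [/\ j = 0 ->
        ratio = cst (1 / zeta 6) +O_ +oo (fun X : R => X `^ (- (5 / 12))),
      j = 1728 ->
        ratio = cst (1 / zeta 4) +O_ +oo (fun X : R => X `^ (- (1 / 4)))
    & j != 0 -> j != 1728 ->
        ratio = cst (1 / zeta 2) +O_ +oo (fun X : R => X `^ (- (1 / 12)))].
Proof.
move=> ratio; rewrite /ratio => {ratio}.
have alpha0 : 0 < alpha by exact: lt_le_trans halpha.
have beta0 : 0 < beta by exact: lt_le_trans hbeta.
split=> [->|->|j0 j1728].
(* Here k = 6, r = 2 and C = [beta]; [nearO_ratio] takes k - 2 and r - 1 as arguments. *)
- have -> : 5 / 12 = (1 - 6%:R^-1) / 2%:R :> R by field.
  apply: (@nearO_ratio R alpha beta beta 0 (pair 0) 4 1 beta0).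
  + by move=> x y [].
  + exact: with_jinv0P.
  + move=> d d0.
    have jE := (with_jinv0P (0, d)).2 (ex_intro2 _ _ d d0 erefl).
    apply: (minimal_curves_axisP _ jE d0) => [|p]; first exact: ltn0Sn.
    by rewrite /fst /snd absz0 dvdn0.
  + move=> d; rewrite /height/= normr0 expr0n mulr0 max_r.
      by rewrite natr_absz intr_norm real_normK ?num_real.
    by rewrite mulr_ge0 ?sqr_ge0//; exact: ltW.
(* Here k = 4, r = 3 and C = [alpha]. *)
- have -> : 1 / 4 = (1 - 4%:R^-1) / 3%:R :> R by field.
  apply: (@nearO_ratio R alpha beta alpha 1728 (pair^~ 0) 2 2 alpha0).
  + by move=> x y [].
  + exact: with_jinv1728P.
  + move=> d d0.
    have jE := (with_jinv1728P (d, 0)).2 (ex_intro2 _ _ d d0 erefl).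
    apply: (minimal_curves_axisP _ jE d0) => [|p]; first exact: ltn0Sn.
    by rewrite /fst /snd absz0 dvdn0 andbT.
  + move=> d; rewrite /height/= expr0n mulr0 max_l.
      by rewrite natr_absz intr_norm.
    by rewrite mulr_ge0 ?exprn_ge0//; exact: ltW.
(* Here k = 2, r = 6, and C is the height of a primitive curve. *)
have -> : 1 / 12 = (1 - 2%:R^-1) / 6%:R :> R by field.
have [E EP] := primitive_curve_ex j0 j1728.
have [/with_jinv_genericP -/(_ j1728)[B0 _] _] := EP.
have A0 := with_jinv_generic_neq0 j0 j1728 EP.1.
have C0 : 0 < height alpha beta E.
  rewrite /height lt_max; apply/orP; left.
  by rewrite mulr_gt0 ?exprn_gt0// normr_gt0 intr_eq0.
apply: (nearO_ratio C0 (twist_inj A0 B0)).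
- by move=> E'; exact: primitive_curveP.
- by move=> d d0; exact: (minimal_twistP j0 j1728 EP).
- exact: height_twist.
Qed.
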